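(* Let $\mathcal N$ be a $d$-dimensional real normed space. Then \[\kappa'(\mathcal N)\le\kappa(\mathcal N)\le P\!\left(\mathcal N,2\left(1+\tfrac1d\right)\right)(d+O(1))\log d=O(3^d d\log d),\] where the $O(\cdot)$ terms hide absolute constants independent of $d$ and $\mathcal N$.
   Context: Let $K$ be the unit ball of $\mathcal N$ (an $o$-symmetric convex body, i.e. compact convex with non-empty interior and $K=-K$). A positive homothet of $K$ is $\lambda K+v$ with $\lambda>0$, $v\in\mathbb{R}^d$ (center $v$). A Minkowski arrangement of $K$ is a family $\{v_i+\lambda_iK\}$ of positive homothets with $v_i\notin v_j+\lambda_j\,\mathrm{int}(K)$ for all $i\ne j$; a strict one has $v_i\notin v_j+\lambda_jK$ for $i\neq j$. $\kappa(\mathcal N)=\kappa(K)$ (resp. $\kappa'(\mathcal N)$) is the largest size of a pairwise intersecting Minkowski (resp. strict Minkowski) arrangement of $K$. The packing number $P(\mathcal N,\lambda)$ is the maximum number of points in $\mathcal N$ such that the ratio of the maximal pairwise distance to the minimal pairwise distance is at most $\lambda$. *)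

(* Defs.v *)
From HB Require Import structures.
From mathcomp Require Import all_boot all_order all_algebra.
From mathcomp Require Import all_classical all_reals all_analysis.
From mathcomp Require Import Rstruct.
Set Implicit Arguments. Unset Strict Implicit. Unset Printing Implicit Defensive.
Import Order.TTheory GRing.Theory Num.Theory.
Local Open Scope classical_set_scope.
Local Open Scope ring_scope.

Notation RR := Rdefinitions.R.
Notation vec d := 'rV[RR]_d.

Definition is_norm (d : nat) (N : vec d -> RR) : Prop :=
  [/\ forall x, N x = 0 -> x = 0,
      forall (a : RR) x, N (a *: x) = `|a| * N x
    & forall x y, N (x + y) <= N x + N y].

(* the positive homothet v + lam K of the unit ball K = {x | N x <= 1} *)
Definition homothet d (N : vec d -> RR) (v : vec d) (lam : RR) : set (vec d) :=
  [set x | N (x - v) <= lam].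
Definition homothet_int d (N : vec d -> RR) (v : vec d) (lam : RR) : set (vec d) :=
  [set x | N (x - v) < lam].

Definition minkowski_arr d (N : vec d -> RR) n (v : 'I_n -> vec d) (lam : 'I_n -> RR) :=
  (forall i, 0 < lam i) /\
  (forall i j, i != j -> ~ homothet_int N (v j) (lam j) (v i)).

Definition strict_minkowski_arr d (N : vec d -> RR) n (v : 'I_n -> vec d) (lam : 'I_n -> RR) :=
  (forall i, 0 < lam i) /\
  (forall i j, i != j -> ~ homothet N (v j) (lam j) (v i)).

Definition pairwise_intersecting d (N : vec d -> RR) n (v : 'I_n -> vec d) (lam : 'I_n -> RR) :=
  forall i j, homothet N (v i) (lam i) `&` homothet N (v j) (lam j) !=set0.

Definition kappa d (N : vec d -> RR) : \bar RR :=
  ereal_sup [set (n%:R)%:E | n in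
    [set n : nat | exists (v : 'I_n -> vec d) (lam : 'I_n -> RR), minkowski_arr N v lam /\ pairwise_intersecting N v lam]].

Definition kappa' d (N : vec d -> RR) : \bar RR :=
  ereal_sup [set (n%:R)%:E | n in
    [set n : nat | exists (v : 'I_n -> vec d) (lam : 'I_n -> RR), strict_minkowski_arr N v lam /\ pairwise_intersecting N v lam]].

Definition packing_number d (N : vec d -> RR) (lam : RR) : \bar RR :=
  ereal_sup [set (n%:R)%:E | n in
    [set n : nat | exists p : 'I_n -> vec d, injective p /\
       forall i j k l, i != j -> k != l -> N (p i - p j) <= lam * N (p k - p l)]].

(* Main.v *)
(** Let [mu] be the smallest radius of a pairwise intersecting Minkowski
arrangement and [t = 1 + 1/d]. Centres with radii in [[r, t r]] have mutual
distances in [[r, 2 t r]], so each such class has at most [P = P(N, 2 t)]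
members, and about [(d + 1) ln (d + 1)] classes cover the radii below
[(d + 1) mu]. The homothets of radius at least [(d + 1) mu] all meet the smallest
one; seen from its centre, their centres have normalized directions at mutual
distance at least [1 - 1/(d + 1)], and at most 2, which is again the ratio [2 t].

For [P <= e 3^d] no volume is needed. Let [p_1, ..., p_n] have mutual distances
in [[e, L e]] and let [c (L + 1) < 1]. The [n^k] images of the origin under words
of length [k] in the contractions [x |-> (1 - c) p_i + c x] stay in a bounded set
and are separated by a multiple of [c^k], so by pigeonhole on a grid
[n^k <= A (c^-d)^k] with [A] independent of [k]. Hence [n <= c^-d], and
[c = (3 + 3/d)^-1] gives [(3 (1 + 1/d))^d <= e 3^d]. *)

Require Import Defs.
From HB Require Import structures.
From mathcomp Require Import all_boot all_order all_algebra.
From mathcomp Require Import all_classical all_reals all_analysis.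
From mathcomp Require Import Rstruct.
From mathcomp Require Import ring lra.
Set Implicit Arguments. Unset Strict Implicit. Unset Printing Implicit Defensive.
Import Order.TTheory GRing.Theory Num.Theory.
Local Open Scope ring_scope.

(** * Preliminaries: norms and the growth of powers *)

Section Norm.
Context {d : nat} {N : vec d -> RR} (hN : is_norm N).

Lemma is_norm0 : N 0 = 0.
Proof. by case: hN => _ h _; have := h 0 0; rewrite scale0r normr0 mul0r. Qed.

Lemma is_normZ a x : N (a *: x) = `|a| * N x.
Proof. by case: hN. Qed.

Lemma is_normN x : N (- x) = N x.
Proof. by rewrite -scaleN1r is_normZ normrN1 mul1r. Qed.

Lemma is_normD x y : N (x + y) <= N x + N y.
Proof. by case: hN. Qed.

Lemma is_normC x y : N (x - y) = N (y - x).
Proof. by rewrite -is_normN opprB. Qed.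

Lemma is_norm_ge0 x : 0 <= N x.
Proof. by have := is_normD x (- x); rewrite subrr is_norm0 is_normN; lra. Qed.

Lemma is_norm_dist x y z : N (x - z) <= N (x - y) + N (y - z).
Proof. by rewrite -[x - z](subrKA y) is_normD. Qed.

Lemma is_norm_distB x y : N x - N y <= N (x - y).
Proof. by have := is_norm_dist x y 0; rewrite !subr0; lra. Qed.

(** Expand [x] in the standard basis. This links coordinates to [N]: points in one grid cell are
    close in [N]. *)
Lemma is_norm_le_coord (h : RR) (x : vec d) : (forall i, `|x 0 i| <= h) ->
  N x <= h * \sum_(i < d) N 'e_i.
Proof.
move=> hx; rewrite [x in N x]row_sum_delta mulr_sumr.
elim/big_rec2: _ => [|i y z _ IH]; first by rewrite is_norm0.
rewrite (le_trans (is_normD _ _))// lerD// is_normZ ler_wpM2r//.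
exact: is_norm_ge0.
Qed.

End Norm.

(** Bernoulli's inequality makes the powers of any [x > 1] unbounded. This disposes of the constant
    factor in the pigeonhole count. *)
Lemma natr_pow_bounded_le1 (R : archiRealFieldType) (x A : R) :
  (forall k, x ^+ k <= A) -> x <= 1.
Proof.
move=> xA; rewrite leNgt; apply/negP => x1.
have bern k : 1 + (x - 1) *+ k <= x ^+ k.
  elim: k => [|k IH]; first by rewrite mulr0n addr0.
  rewrite exprS mulrS; have := ler_wpM2l (ltW (lt_trans ltr01 x1)) IH.
  have : 0 <= (x - 1) *+ k by rewrite mulrn_wge0// subr_ge0 ltW.
  by nra.
have := archi_boundP (divr_ge0 (normr_ge0 A) (ltW (_ : 0 < x - 1))).
rewrite subr_gt0 => /(_ x1); rewrite ltr_pdivrMr ?subr_gt0// => Ak.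
have := le_trans (bern _) (xA (Num.bound (`|A| / (x - 1)))).
by rewrite -mulr_natl; have := ler_norm A; lra.
Qed.

(** * Separated points counted through words in contractions *)

Section Words.
Context {d n : nat} (N : vec d -> RR) (p : 'I_n -> vec d) (c : RR).

(** The first letter is the outermost contraction, so a common first letter strips off as a factor
    [c]. *)
Fixpoint word_point (w : seq 'I_n) : vec d :=
  if w is i :: w' then (1 - c) *: p i + c *: word_point w' else 0.

Lemma word_point_coord (B : RR) w j : 0 <= c <= 1 -> 0 <= B ->
  (forall i, `|p i 0 j| <= B) -> `|word_point w 0 j| <= B.
Proof.
move=> /andP[c0 c1] B0 hp; elim: w => [|i w IH] /=; first by rewrite mxE normr0.
rewrite !mxE (le_trans (ler_normD _ _))// !normrM (ger0_norm c0).
rewrite ger0_norm ?subr_ge0//.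
by have := hp i; nra.
Qed.

Hypotheses (hN : is_norm N) (c01 : 0 <= c <= 1).

Lemma word_point_diam (D : RR) w w' : 0 <= D ->
  (forall i j, N (p i - p j) <= D) -> size w = size w' ->
  N (word_point w - word_point w') <= D.
Proof.
case/andP: c01 => c0 c1 D0 hD.
elim: w w' => [|i w IH] [|j w']//=; first by rewrite subrr is_norm0.
move=> [/IH hw].
rewrite opprD addrACA -!scalerBr (le_trans (is_normD hN _ _))// !(is_normZ hN).
by rewrite (ger0_norm c0) ger0_norm ?subr_ge0//; have := hD i j; nra.
Qed.

(** Each letter of the common prefix costs a factor [c]. At the first difference the leading terms
    are at least [(1 - c) * e] apart and the tails contribute at most [c * D], which leaves
    [e - c * (D + e)]. *)
Lemma word_point_separated (D e : RR) w w' : 0 <= D -> c * (D + e) <= e ->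
  (forall i j, N (p i - p j) <= D) -> (forall i j, i != j -> e <= N (p i - p j)) ->
  size w = size w' -> w != w' ->
  c ^+ size w * (e - c * (D + e)) <= N (word_point w - word_point w').
Proof.
case/andP: c01 => c0 c1 D0 ce hD he.
elim: w w' => [|i w IH] [|j w']//= [sw]; rewrite opprD addrACA -!scalerBr.
rewrite eqseq_cons negb_and; case: eqVneq => [->|ij] /=.
  move=> /(IH _ sw); rewrite subrr scaler0 add0r (is_normZ hN) (ger0_norm c0).
  by move=> ?; rewrite exprS -mulrA ler_wpM2l.
move=> _; have := is_norm_distB hN ((1 - c) *: (p i - p j))
    (- (c *: (word_point w - word_point w'))).
rewrite opprK is_normN// !(is_normZ hN) (ger0_norm c0) ger0_norm ?subr_ge0//.
have := he _ _ ij; have := word_point_diam D0 hD sw.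
set X := N _; set Y := N _; set Z := N _ => XD eY XYZ.
have : c ^+ (size w).+1 <= 1 by rewrite exprn_ile1.
by nra.
Qed.

End Words.

Lemma separated_points_card {d n : nat} (N : vec d -> RR) (p : 'I_n -> vec d)
    (c D e : RR) :
  is_norm N -> 0 < c <= 1 -> 0 <= D -> c * (D + e) < e ->
  (forall i j, N (p i - p j) <= D) -> (forall i j, i != j -> e <= N (p i - p j)) ->
  n%:R * c ^+ d <= 1.
Proof.
move=> hN /andP[c0 c1] D0 ce hD he.
pose g := e - c * (D + e); have g0 : 0 < g by rewrite subr_gt0.
pose M := 1 + \sum_(i < d) N 'e_i.
have M0 : 0 < M by rewrite ltr_pwDl// sumr_ge0// => i _; exact: is_norm_ge0.
pose B := \sum_i \sum_j `|p i 0 j|.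
have pB i j : `|p i 0 j| <= B.
  rewrite /B (bigD1 i)//= (bigD1 j)//= -addrA lerDl addr_ge0// sumr_ge0// => *.
  by rewrite sumr_ge0.
have B0 : 0 <= B by rewrite sumr_ge0// => *; rewrite sumr_ge0.
apply: (@natr_pow_bounded_le1 _ _ ((2 * B * M / g + 1) ^+ d)) => k.
(* Mesh of the grid: two points in one cell differ by at most [h * (M - 1)] in [N], strictly less
   than the separation [c ^+ k * g = h * M]. *)
pose h := c ^+ k * g / M.
have ck0 : 0 < c ^+ k by rewrite exprn_gt0.
have h0 : 0 < h by rewrite divr_gt0// mulr_gt0.
pose T := Num.truncn (2 * B / h).
have Th : T%:R <= 2 * B / h by rewrite truncn_le divr_ge0 ?(ltW h0) ?mulr_ge0.
pose x (w : k.-tuple 'I_n) := word_point p c w.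
have xB w j : - B <= x w 0 j <= B.
  by rewrite -ler_norml; apply: word_point_coord; rewrite ?(ltW c0).
pose q w j := (x w 0 j + B) / h.
have q0 w j : 0 <= q w j.
  by rewrite divr_ge0 ?(ltW h0)//; case/andP: (xB w j); lra.
have qT w j : (Num.truncn (q w j) < T.+1)%N.
  rewrite ltnS le_truncn// ler_wpM2r ?invr_ge0 ?(ltW h0)//.
  by case/andP: (xB w j); lra.
pose f w : {ffun 'I_d -> 'I_T.+1} := [ffun j => Ordinal (qT w j)].
have f_inj : injective f.
  move=> w w' /ffunP ff; apply/eqP; apply: contraT => ww'.
  have : N (x w - x w') <= h * \sum_(i < d) N 'e_i.
    apply: is_norm_le_coord => // j.
    have := ff j; rewrite !ffunE => /(congr1 val) /= tt.
    have /andP[] := truncn_itv (q0 w j); have /andP[] := truncn_itv (q0 w' j).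
    rewrite -tt -!natr1 ler_pdivlMr// ltr_pdivrMr// ler_pdivlMr// ltr_pdivrMr//.
    by move=> ? ? ? ?; rewrite !mxE ler_norml; apply/andP; split; lra.
  have := @word_point_separated _ _ _ p _ hN _ D e w w' D0 (ltW ce) hD he.
  rewrite !size_tuple (ltW c0) c1 => /(_ isT erefl ww').
  rewrite -/g -/(x w) -/(x w') => h1 h2; have := le_trans h1 h2.
  have -> : c ^+ k * g = h * M by rewrite divfK// gt_eqF.
  by rewrite ler_pM2l// /M; lra.
have := leq_card f f_inj; rewrite card_tuple card_ffun !card_ord => nT.
have {}nT : n%:R ^+ k <= T.+1%:R ^+ d :> RR by rewrite -!natrX ler_nat.
(* The factor [c ^+ k] cancels against the one in [h], and [c <= 1] absorbs the extra cell, so the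
   bound is free of [k]. *)
have TA : T.+1%:R * c ^+ k <= 2 * B * M / g + 1.
  rewrite -natr1 mulrDl lerD ?mul1r//; last by rewrite exprn_ile1// ltW.
  rewrite -ler_pdivlMr// (le_trans Th)// /h le_eqVlt; apply/orP; left.
  by apply/eqP; field; rewrite !gt_eqF.
rewrite exprMn -exprM mulnC exprM.
apply: (@le_trans _ _ (T.+1%:R ^+ d * (c ^+ k) ^+ d)).
  by rewrite ler_wpM2r// exprn_ge0// ltW.
by rewrite -exprMn lerXn2r// ?nnegrE ?mulr_ge0 ?addr_ge0 ?divr_ge0 ?mulr_ge0// ltW.
Qed.

(** * Bounds on packing numbers *)

Section Packing.
Context {d : nat} {N : vec d -> RR} (hN : is_norm N).

Lemma packing_number_card (I : finType) (S : {set I}) (q : I -> vec d) (L e : RR) :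
  0 < e -> 0 <= L ->
  {in S &, forall i j, i != j -> e <= N (q i - q j) <= L * e} ->
  ((#|S|%:R)%:E <= packing_number N L)%E.
Proof.
move=> e0 L0 hS; apply: ereal_sup_ubound; exists #|S| => //.
have hp (i j : 'I_#|S|) : i != j ->
    e <= N (q (enum_val i) - q (enum_val j)) <= L * e.
  by move=> ij; apply: hS; rewrite ?enum_valP// (inj_eq enum_val_inj).
exists (q \o enum_val); split => [i j /= qij|i j k l /hp /andP[_ ij] /hp /andP[kl _]].
  apply/eqP; apply: contraT => /hp.
  by rewrite qij subrr (is_norm0 hN); lra.
by rewrite (le_trans ij)// ler_wpM2l.
Qed.

Lemma packing_number_ge0 L : (0 <= packing_number N L)%E.
Proof.
apply: ereal_sup_ubound; exists 0%N => //.
by exists (fun=> 0); split=> [[]//|[]].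
Qed.

Lemma packing_number_le (L c : RR) : 0 <= L -> 0 < c -> c * (L + 1) < 1 ->
  (packing_number N L <= ((c ^+ d)^-1)%:E)%E.
Proof.
move=> L0 c0 cL; have c1 : c <= 1 by nra.
have cd0 : 0 < c ^+ d by rewrite exprn_gt0.
apply: ge_ereal_sup => _ [n [p [p_inj hp]] <-]; rewrite lee_fin.
(* With fewer than two points there is no minimal distance to scale by; the bound is then at least 1
   because [c <= 1]. *)
case: n p p_inj hp => [|[|n]] p p_inj hp; first by rewrite invr_ge0 ltW.
  by rewrite invf_ge1// exprn_ile1// ltW.
pose a : 'I_n.+2 := ord0; pose b : 'I_n.+2 := ord_max.
case: (@arg_minP _ RR ('I_n.+2 * 'I_n.+2)%type (a, b) (fun x => x.1 != x.2)
  (fun x => N (p x.1 - p x.2))) => //= -[k l] /= kl kl_min.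
set e := N (p k - p l) in kl_min *.
have e0 : 0 < e.
  rewrite lt_neqAle is_norm_ge0// andbT eq_sym; apply/eqP.
  by case: hN => hN0 _ _ /hN0 /subr0_eq /p_inj klE; rewrite klE eqxx in kl.
rewrite -[leRHS]mul1r ler_pdivlMr//.
apply: (@separated_points_card d n.+2 N p c (L * e) e) => //.
- by rewrite c0.
- by rewrite mulr_ge0// ltW.
- by nra.
- move=> i j; have [->|ij] := eqVneq i j; last exact: hp.
  by rewrite subrr (is_norm0 hN) mulr_ge0// ltW.
- by move=> i j ij; exact: (kl_min (i, j)).
Qed.

End Packing.

(** * Counting the homothets of an arrangement *)

Section Arrangement.
Context {d n : nat} {N : vec d -> RR} (hN : is_norm N).
Context {v : 'I_n -> vec d} {lam : 'I_n -> RR}.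
Hypotheses (hM : minkowski_arr N v lam) (hI : pairwise_intersecting N v lam).

Lemma center_dist_le i j : N (v i - v j) <= lam i + lam j.
Proof.
have [x [/= xi xj]] := hI i j; apply: (le_trans (is_norm_dist hN (v i) x (v j))).
by rewrite (is_normC hN (v i)) lerD.
Qed.

Lemma center_dist_ge i j : i != j -> lam i <= N (v i - v j).
Proof.
case: hM => _ h; rewrite eq_sym => /h; rewrite (is_normC hN (v i)) leNgt.
by move=> ?; apply/negP.
Qed.

Lemma arrangement_class_card (s t : RR) : 0 < s -> 0 <= t ->
  ((#|[set i | (s <= lam i <= t * s)%R]|%:R)%:E <= packing_number N (2 * t)%R)%E.
Proof.
move=> s0 t0; apply: (packing_number_card hN (q := v) s0); first by rewrite mulr_ge0.
move=> i j; rewrite !inE => /andP[si it] /andP[sj jt] ij.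
by rewrite (le_trans si (center_dist_ge ij)) (le_trans (center_dist_le i j))//; lra.
Qed.

(** For [r a <= r b], the triangle inequality gives [r a * N (u a - u b) >= N (v b - v a) - (r b - r
    a)]. Here [N (v b - v a) >= lam b] and [r b <= lam b + lam i], so the right side is at least
    [r a - lam i], and [lam i <= r a / s]. *)
Lemma normalized_dist_ge (s : RR) (a b i : 'I_n) : 0 < s ->
  let r j := N (v j - v i) in let u j := (r j)^-1 *: (v j - v i) in
  a != b -> a != i -> b != i -> s * lam i <= lam a -> s * lam i <= lam b ->
  1 - s^-1 <= N (u a - u b).
Proof.
move=> s0 r u.
wlog rab : a b / r a <= r b => [hw ab ai bi sa sb|].
  have [rab|/ltW rba] := leP (r a) (r b); first exact: hw.
  by rewrite (is_normC hN); apply: hw => //; rewrite eq_sym.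
move=> ab ai bi sa sb; have i0 : 0 < lam i by case: hM.
have ra : s * lam i <= r a := le_trans sa (center_dist_ge ai).
have ra0 : 0 < r a by rewrite (lt_le_trans _ ra)// mulr_gt0.
have rb0 := lt_le_trans ra0 rab.
(* Shrink the farther centre [v b] towards [v i] to the distance [r a]. *)
have hu : r a * N (u a - u b) = N ((v a - v i) - (r a / r b) *: (v b - v i)).
  rewrite -{1}(gtr0_norm ra0) -(is_normZ hN) /u scalerBr !scalerA divff ?gt_eqF//.
  by rewrite scale1r.
have hb : N ((v b - v i) - (r a / r b) *: (v b - v i)) = r b - r a.
  rewrite -[X in X - _]scale1r -scalerBl (is_normZ hN) ger0_norm.
    by rewrite mulrBl mul1r divfK// gt_eqF.
  by rewrite subr_ge0 ler_pdivrMr// mul1r.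
have := is_norm_dist hN (v b - v i) ((r a / r b) *: (v b - v i)) (v a - v i).
rewrite hb (is_normC hN (_ *: _)) -hu.
have -> : v b - v i - (v a - v i) = v b - v a by rewrite opprB addrA subrK.
have ba : b != a by rewrite eq_sym.
have := center_dist_ge ba; have := center_dist_le b i; rewrite -/(r b) => h1 h2 h3.
rewrite -(ler_pM2l ra0) mulrBr mulr1.
have : lam i <= r a / s by rewrite ler_pdivlMr// mulrC.
by lra.
Qed.

Lemma arrangement_large_card (s : RR) i : 1 < s ->
  ((#|[set j | (s * lam i <= lam j)%R]|%:R)%:E <= packing_number N (2 / (1 - s^-1))%R)%E.
Proof.
move=> s1; have s0 : 0 < s by lra.
have sV : 0 < 1 - s^-1 by rewrite subr_gt0 invf_lt1.
pose r j := N (v j - v i); pose u j := (r j)^-1 *: (v j - v i).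
apply: (packing_number_card hN (q := u) sV); first by rewrite divr_ge0 ?ltW.
move=> a b; rewrite !inE => ha hb ab; rewrite divfK ?gt_eqF//.
have i0 : 0 < lam i by case: hM.
(* As [s > 1], the index [i], which has no direction from its own centre, stays outside the set. *)
have neq j : s * lam i <= lam j -> j != i.
  by move=> sj; apply/eqP => ji; rewrite ji in sj; nra.
rewrite (normalized_dist_ge s0 ab) ?neq//=.
have u1 j : s * lam i <= lam j -> N (u j) <= 1.
  move=> sj; have rj : 0 < r j.
    by rewrite (lt_le_trans _ (center_dist_ge (neq _ sj)))//; case: hM.
  by rewrite (is_normZ hN) gtr0_norm ?invr_gt0// -/(r j) mulVf// lt0r_neq0.
apply: (le_trans (is_normD hN _ _)); rewrite (is_normN hN).
by have := u1 _ ha; have := u1 _ hb; lra.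
Qed.

Lemma arrangement_card (t s P : RR) (m : nat) : 1 <= t -> 1 < s -> s <= t ^+ m ->
  2 / (1 - s^-1) <= 2 * t ->
  packing_number N (2 * t) = P%:E -> n%:R <= m.+1%:R * P.
Proof.
move=> t1 s1 stm st hP.
have P0 : 0 <= P by rewrite -lee_fin -hP packing_number_ge0.
case: (posnP n) => [->|n0]; first by rewrite mulr_ge0.
case: (@arg_minP _ RR _ (Ordinal n0) xpredT lam) => // i _ i_min.
have i0 : 0 < lam i by case: hM.
(* [S 0] is empty by minimality of [lam i], and passing from [S k] to [S k.+1] adds at most one
   class of radii. *)
pose S k := [set j | lam j < lam i * t ^+ k].
have hS k : #|S k|%:R <= k%:R * P.
  elim: k => [|k IH].
    rewrite mul0r (_ : S 0%N = finset.set0) ?cards0//; apply/setP => j.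
    by rewrite !inE expr0 mulr1 ltNge i_min.
  have tk0 : 0 < lam i * t ^+ k by rewrite mulr_gt0// exprn_gt0; lra.
  have := arrangement_class_card tk0 (le_trans ler01 t1).
  rewrite hP lee_fin; set A := [set _ | _] => hA.
  have SA : (#|S k.+1| <= #|S k| + #|A|)%N.
    rewrite (leq_trans _ (leq_card_setU _ _))// subset_leq_card//.
    apply/fintype.subsetP => j; rewrite !inE exprSr mulrA => /ltW jk.
    by rewrite [t * _]mulrC jk andbT; case: ltP.
  rewrite -natr1 mulrDl mul1r (le_trans _ (lerD IH hA))//.
  by rewrite -natrD ler_nat.
have := arrangement_large_card i s1.
set A := [set _ | _] => hA.
(* The ratio [2 / (1 - s^-1)] may lie below [2 * t]; packing numbers are monotone in the ratio. *)
have {}hA : #|A|%:R <= P.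
  rewrite -lee_fin -hP (le_trans hA)//; apply: ereal_sup_le.
  move=> _ [k [p [p_inj hp]] <-]; exists k => //; exists p; split => //.
  move=> a b x y ab xy; rewrite (le_trans (hp _ _ _ _ ab xy))//.
  by rewrite ler_wpM2r// is_norm_ge0.
have nSA : (n <= #|S m| + #|A|)%N.
  rewrite (leq_trans _ (leq_card_setU _ _))// -{1}[n]card_ord -cardsT.
  rewrite subset_leq_card//; apply/fintype.subsetP => j _; rewrite !inE.
  case: ltP => //=; apply: le_trans.
  by rewrite mulrC ler_pM2l.
rewrite -natr1 mulrDl mul1r (le_trans _ (lerD (hS m) hA))//.
by rewrite -natrD ler_nat.
Qed.

End Arrangement.

(** * The number of radius classes and the final bounds *)

Lemma ln_class_count (R : realType) (d : nat) : (2 <= d)%N ->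
  exists m : nat, d%:R + 1 <= (1 + (d%:R)^-1) ^+ m :> R /\
    m.+1%:R <= (d%:R + 8) * ln (d%:R : R).
Proof.
move=> d2; have D2 : 2 <= d%:R :> R by rewrite ler_nat.
have D0 : 0 < d%:R :> R by lra.
set D : R := d%:R in D2 D0 *.
have DV0 : 0 < D^-1 by rewrite invr_gt0.
(* Applied to reciprocals, [ln y <= y - 1] yields lower bounds for [ln 2] and [ln (1 + D^-1)]. *)
have lnDV (x : R) : 0 < x -> ln x^-1 <= x^-1 - 1.
  move=> x0; have := @le_ln1Dx R (x^-1 - 1).
  rewrite [1 + _]addrC subrK; apply; have : 0 < x^-1 by rewrite invr_gt0.
  by lra.
have lnD : 1 / 2 <= ln D.
  apply: (@le_trans _ _ (ln 2)); last by rewrite ler_ln ?posrE.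
  by have := lnDV 2; rewrite lnV ?posrE//; lra.
have lnq : (D + 1)^-1 <= ln (1 + D^-1).
  have := lnDV (1 + D^-1); rewrite lnV ?posrE; last by lra.
  have -> : (1 + D^-1)^-1 - 1 = - (D + 1)^-1.
    by field; rewrite !gt_eqF//; lra.
  by lra.
have lnD1 : ln (D + 1) <= ln D + D^-1.
  have -> : D + 1 = D * (1 + D^-1) by rewrite mulrDr mulr1 divff// gt_eqF.
  rewrite lnM ?posrE//; last by lra.
  by rewrite lerD2l le_ln1Dx//; lra.
have lnD0 : 0 <= ln (D + 1) by rewrite ln_ge0; lra.
pose x := (D + 1) * ln (D + 1).
have x0 : 0 <= x by rewrite mulr_ge0; lra.
(* Since [ln (1 + D^-1) >= (D + 1)^-1], any exponent [m >= x] suffices. *)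
exists (Num.truncn x).+1; have /andP[mx xm] := truncn_itv x0.
split.
  rewrite -ler_ln ?posrE ?exprn_gt0; try lra.
  rewrite lnXn; last by lra.
  rewrite -mulr_natr; apply: (@le_trans _ _ ((D + 1)^-1 * x)).
    by rewrite /x mulKf// gt_eqF//; lra.
  by rewrite ler_pM ?invr_ge0 ?(ltW xm)//; lra.
(* Now [m.+1 <= x + 2 <= (D + 1) * ln D + 3 + D^-1], and [3 + D^-1 <= 7 / 2 <= 7 * ln D]: this is
   where 8 = 1 + 7 arises. *)
rewrite -2!natr1.
have : x <= (D + 1) * (ln D + D^-1) by rewrite ler_wpM2l//; lra.
have : D^-1 <= 1 / 2 by rewrite mul1r lef_pV2 ?posrE.
have : (D + 1) * (ln D + D^-1) = (D + 1) * ln D + 1 + D^-1.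
  by field; rewrite gt_eqF.
by lra.
Qed.

Local Open Scope ereal_scope.

Theorem theorem9 :
  exists C1 C2 : RR,
  forall (d : nat) (N : vec d -> RR), (2 <= d)%N -> is_norm N ->
    [/\ kappa' N <= kappa N,
        kappa N <= packing_number N (2 * (1 + (d%:R)^-1))%R
                     * ((d%:R + C1) * ln (d%:R : RR))%:E
      & packing_number N (2 * (1 + (d%:R)^-1))%R
                     * ((d%:R + C1) * ln (d%:R : RR))%:E
          <= (C2 * 3 ^+ d * d%:R * ln (d%:R : RR))%:E].
Proof.
(* The 8 comes from the class count; the second constant combines [P <= e 3^d] with
   [d + 8 <= 9 d]. *)
exists 8%R, (expR 1 * 9)%R => d N d2 hN.
have D2 : (2 <= d%:R :> RR)%R by rewrite ler_nat.
have D0 : (0 < d%:R :> RR)%R by lra.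
have lnd0 : (0 <= ln (d%:R : RR))%R by rewrite ln_ge0; lra.
set D : RR := d%:R%R in D2 D0 lnd0 *.
have DV0 : (0 < D^-1)%R by rewrite invr_gt0.
have hP : packing_number N (2 * (1 + D^-1))%R <= (expR 1 * 3 ^+ d)%:E.
  (* With [L = 2 (1 + 1/d)], [L + 1 = 3 + 2/d]; taking [3 + 3/d] instead makes [c (L + 1) < 1]
     strict and factors out 3. *)
  have c0 : (0 < (3 * (1 + D^-1))^-1)%R by rewrite invr_gt0; lra.
  apply: le_trans (packing_number_le hN _ c0 _) _.
  - by lra.
  - by rewrite mulrC ltr_pdivrMr; lra.
  rewrite lee_fin exprVn invrK exprMn [leRHS]mulrC ler_pM2l ?exprn_gt0//.
  have <- : (expR (D^-1) ^+ d = expR 1 :> RR)%R by rewrite -expRM_natr mulVf ?gt_eqF.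
  by rewrite lerXn2r ?nnegrE ?expR_ge1Dx ?expR_ge0//; lra.
have [P PE] : exists P, packing_number N (2 * (1 + D^-1))%R = P%:E.
  exists (fine (packing_number N (2 * (1 + D^-1))%R)); rewrite fineK//.
  rewrite ge0_fin_numE ?packing_number_ge0//.
  by rewrite (le_lt_trans hP)// ltry.
have P0 : (0 <= P)%R by rewrite -lee_fin -PE packing_number_ge0.
rewrite PE -EFinM; split.
- apply: ereal_sup_le => _ [n [v [lam [[lam0 hM] hI]]] <-].
  exists n => //; exists v, lam; split => //; split => // i j ij.
  by move=> /ltW; exact: hM.
- apply: ge_ereal_sup => _ [n [v [lam [hM hI]]] <-]; rewrite lee_fin.
  have [m [hm mD]] := @ln_class_count RR d d2.
  (* The choice [s = D + 1] makes [2 / (1 - s^-1)] equal to [2 * (1 + D^-1)], so large homothets and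
     radius classes share one packing number. *)
  have := @arrangement_card _ _ _ hN _ _ hM hI (1 + D^-1)%R (D + 1)%R P m.
  move=> /(_ _ _ hm _ PE) nP.
  apply: le_trans (nP _ _ _) _; [by lra|by lra| |].
    rewrite le_eqVlt; apply/orP; left; apply/eqP; field.
    by rewrite !gt_eqF//; lra.
  by rewrite mulrC ler_wpM2l.
- rewrite lee_fin; rewrite PE lee_fin in hP.
  rewrite !mulrA ler_wpM2r//.
  apply: (@le_trans _ _ (expR 1 * 3 ^+ d * (9 * D))%R).
    by rewrite ler_pM//; lra.
  by rewrite le_eqVlt; apply/orP; left; apply/eqP; ring.
Qed.
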